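(* For every consistent positive-negative pair $\mathcal P$, the formula $\widehat{\mathcal P}$ is satisfiable, i.e. there is a Kripke structure $K^n$ with $K^n_1(\widehat{\mathcal P})=\mathfrak t$.
   Context: Fix a set $\mathrm{Var}$ of propositional variables. LTLf formulae are generated by $\varphi,\psi ::= v \mid \bot \mid \varphi\Rightarrow\psi \mid \mathsf{X}\varphi \mid \varphi\,\mathcal{W}\,\psi$ with $v\in\mathrm{Var}$. Abbreviations: $\neg\varphi := \varphi\Rightarrow\bot$; $\top:=\neg\bot$; $\varphi\vee\psi := \neg\varphi\Rightarrow\psi$; $\varphi\wedge\psi := \neg(\neg\varphi\vee\neg\psi)$; $\varphi\Leftrightarrow\psi := (\varphi\Rightarrow\psi)\wedge(\psi\Rightarrow\varphi)$; $\mathsf{end} := \neg\mathsf{X}\top$; $\bullet\varphi := \neg\mathsf{X}\neg\varphi$; $\Box\varphi := \varphi\,\mathcal{W}\,\bot$; $\Diamond\varphi := \neg\Box\neg\varphi$. Semantics: a Kripke structure is a finite nonempty sequence $K^n=(\eta_1,\dots,\eta_n)$, $n\ge 1$, of valuations $\eta_i:\mathrm{Var}\to\{\mathfrak t,\mathfrak f\}$. For $1\le i\le n$: $K^n_i(v)=\eta_i(v)$; $K^n_i(\bot)=\mathfrak f$; $K^n_i(\varphi\Rightarrow\psi)=\mathfrak t$ iff $K^n_i(\varphi)=\mathfrak f$ or $K^n_i(\psi)=\mathfrak t$; $K^n_i(\mathsf{X}\varphi)=K^n_{i+1}(\varphi)$ if $i<n$ and $\mathfrak f$ if $i=n$; $K^n_i(\varphi\,\mathcal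 W\,\psi)=\mathfrak t$ iff either $K^n_j(\varphi)=\mathfrak t$ for all $i\le j\le n$, or there is $i\le k\le n$ with $K^n_k(\psi)=\mathfrak t$ and $K^n_j(\varphi)=\mathfrak t$ for all $i\le j<k$. Proof system: $\vdash\varphi$ means $\varphi$ is derivable in the system closed under propositional reasoning (all instances of propositional tautologies; modus ponens) together with: (WkNextDistr) $\vdash\bullet(\varphi\Rightarrow\psi)\Leftrightarrow(\bullet\varphi\Rightarrow\bullet\psi)$; (EndNextContra) $\vdash\mathsf{end}\Rightarrow\neg\mathsf{X}\varphi$; (Finite) $\vdash\Diamond\mathsf{end}$; (WkUntilUnroll) $\vdash\varphi\,\mathcal W\,\psi\Leftrightarrow\psi\vee(\varphi\wedge\bullet(\varphi\,\mathcal W\,\psi))$; (WkNextStep) from $\vdash\varphi$ infer $\vdash\bullet\varphi$; (Induction) from $\vdash\varphi\Rightarrow\psi$ and $\vdash\varphi\Rightarrow\bullet\varphi$ infer $\vdash\varphi\Rightarrow\Box\psi$. A positive-negative pair (PNP) $\mathcal P$ is a pair $(\mathrm{pos}(\mathcal P),\mathrm{neg}(\mathcal P))$ of finite sets of formulae. Its literal interpretation is $\widehat{\mathcal P}=\bigwedge_{\varphi\in\mathrm{pos}(\mathcal P)}\varphi\wedge\bigwedge_{\psi\in\mathrm{neg}(\mathcal P)}\neg\psi$ (empty conjunction $=\top$). $\mathcal P$ is inconsistent if $\vdash\neg\widehat{\mathcal P}$, and consistent otherwise.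
   Formalization: As stated the claim fails: pos={Xv}, neg={X¬¬v} is consistent in the listed system but unsatisfiable. The proof system is therefore extended with ⊢ Xφ ⇔ Xψ for all propositionally equivalent φ, ψ. *)

(* Defs.v *)
From HB Require Import structures.
From mathcomp Require Import all_boot finmap boolp.

Set Implicit Arguments.
Unset Strict Implicit.
Unset Printing Implicit Defensive.

Local Open Scope fset_scope.

Inductive formula (Var : Type) : Type :=
| fVar of Var
| fBot
| fImp of formula Var & formula Var
| fX of formula Var
| fW of formula Var & formula Var.

Arguments fBot {Var}.

(* [Var] is an arbitrary type, so equality and choice on formulae, which
   [{fset _}] requires, come from the classical axioms. *)
HB.instance Definition _ (Var : Type) := gen_eqMixin (formula Var).
HB.instance Definition _ (Var : Type) := gen_choiceMixin (formula Var).

Section Connectives.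
Context {Var : Type}.
Implicit Types f g : formula Var.

Definition fNot f := fImp f fBot.
Definition fTop : formula Var := fNot fBot.
Definition fOr f g := fImp (fNot f) g.
Definition fAnd f g := fNot (fOr (fNot f) (fNot g)).
Definition fIff f g := fAnd (fImp f g) (fImp g f).
Definition fEnd : formula Var := fNot (fX fTop).
Definition fWX f := fNot (fX (fNot f)).
Definition fBox f := fW f fBot.
Definition fDiamond f := fNot (fBox (fNot f)).

End Connectives.

Definition valuation (Var : Type) : Type := Var -> bool.

(* Positions are counted from 0: eta_i is [tnth K] at the ordinal of value
   i - 1.  The constraint 0 < n is imposed in [satisfiable]; for n = 0 there
   is no position to evaluate at. *)
Definition kripke (Var : Type) (n : nat) : Type := n.-tuple (valuation Var).

Fixpoint eval (Var : Type) (n : nat) (K : kripke Var n) (f : formula Var)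
    (i : 'I_n) {struct f} : bool :=
  match f with
  | fVar v => tnth K i v
  | fBot => false
  | fImp f g => ~~ eval K f i || eval K g i
  | fX f => if insub i.+1 is Some j then eval K f j else false
  | fW f g =>
      [forall j : 'I_n, (i <= j) ==> eval K f j] ||
      [exists k : 'I_n, [&& i <= k, eval K g k &
        [forall j : 'I_n, (i <= j < k) ==> eval K f j]]]
  end.

Definition satisfiable (Var : Type) (f : formula Var) : Prop :=
  exists (n : nat) (n_gt0 : 0 < n) (K : kripke Var n),
    eval K f (Ordinal n_gt0) = true.

Inductive pform : Type :=
| pAtom of nat
| pBot
| pImp of pform & pform.

Fixpoint peval (a : nat -> bool) (p : pform) : bool :=
  match p with
  | pAtom k => a k
  | pBot => false
  | pImp p q => ~~ peval a p || peval a q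
  end.

Definition tautology (p : pform) : Prop := forall a, peval a p = true.

Fixpoint psubst (Var : Type) (s : nat -> formula Var) (p : pform) :
    formula Var :=
  match p with
  | pAtom k => s k
  | pBot => fBot
  | pImp p q => fImp (psubst s p) (psubst s q)
  end.

Definition prop_equiv (p q : pform) : Prop := forall a, peval a p = peval a q.

(* [TautX] is propositional reasoning below the modality: propositionally
   equivalent formulae may be exchanged under X.  With tautologies and modus
   ponens at the top level only, the other rules constrain X on negated
   arguments alone (through fWX), so that X v and ~ X ~ ~ v would be jointly
   consistent but not satisfiable. *)
Inductive provable (Var : Type) : formula Var -> Prop :=
| Taut (p : pform) (s : nat -> formula Var) :
    tautology p -> provable (psubst s p)
| TautX (p q : pform) (s : nat -> formula Var) :
    prop_equiv p q -> provable (fIff (fX (psubst s p)) (fX (psubst s q)))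
| ModusPonens f g : provable (fImp f g) -> provable f -> provable g
| WkNextDistr f g :
    provable (fIff (fWX (fImp f g)) (fImp (fWX f) (fWX g)))
| EndNextContra f : provable (fImp fEnd (fNot (fX f)))
| Finite_ax : provable (fDiamond fEnd)
| WkUntilUnroll f g :
    provable (fIff (fW f g) (fOr g (fAnd f (fWX (fW f g)))))
| WkNextStep f : provable f -> provable (fWX f)
| Induction f g :
    provable (fImp f g) -> provable (fImp f (fWX f)) ->
    provable (fImp f (fBox g)).

Record pnp (Var : Type) : Type := PNP {
  pos : {fset formula Var};
  neg : {fset formula Var}
}.

(* [fAnd] is not commutative on the nose: the conjuncts appear in the order in
   which [{fset _}] enumerates its elements, ending with [fTop]. *)
Definition literal (Var : Type) (P : pnp Var) : formula Var :=
  fAnd (\big[fAnd/fTop]_(f <- pos P) f) (\big[fAnd/fTop]_(g <- neg P) fNot g).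

Definition inconsistent (Var : Type) (P : pnp Var) : Prop :=
  provable (fNot (literal P)).

Definition consistent (Var : Type) (P : pnp Var) : Prop := ~ inconsistent P.

(* Main.v *)
From mathcomp Require Import all_boot boolp.
Require Import Defs.

Set Implicit Arguments.
Unset Strict Implicit.
Unset Printing Implicit Defensive.

(** Fix a finite list L of formulae containing X T and the subformulae of a
    consistent formula.  A type is a truth assignment to L, with characteristic
    formula [char t]; t' is a successor of t when [char t /\ X (char t')] is
    consistent.  If no type without successor (one refuting X T) were reachable
    from a consistent type t0, the disjunction r of all types reachable from t0
    would satisfy |- r => ~ end and |- r => WX r, so that |- r => [] ~ end by
    induction, against |- <> end.  Hence there is a path from t0 to a type
    satisfying end.  It is a model: along a finite trace the unrolling law alone
    determines the truth values of a weak until, so no eventuality is left to be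
    fulfilled. *)

Section Completeness.
Variable Var : Type.
Implicit Types (f g h : formula Var) (V : formula Var -> bool).

(** * Propositional valuations and propositional derivability *)

Definition prop_valuation V : Prop :=
  V fBot = false /\ forall f g, V (fImp f g) = (V f ==> V g).

Section Connectives.
Variables (V : formula Var -> bool) (hV : prop_valuation V).

Lemma val_bot : V fBot = false. Proof. by case: hV. Qed.

Lemma val_imp f g : V (fImp f g) = (V f ==> V g). Proof. by case: hV. Qed.

Lemma val_not f : V (fNot f) = ~~ V f.
Proof. by rewrite val_imp val_bot implybF. Qed.

Lemma val_top : V fTop = true.
Proof. by rewrite val_not val_bot. Qed.

Lemma val_or f g : V (fOr f g) = V f || V g.
Proof. by rewrite val_imp val_not implyNb. Qed.

Lemma val_and f g : V (fAnd f g) = V f && V g.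
Proof. by rewrite val_not val_or !val_not negb_or !negbK. Qed.

Lemma val_iff f g : V (fIff f g) = (V f == V g).
Proof. by rewrite val_and !val_imp; case: (V f); case: (V g). Qed.

Lemma val_WX f : V (fWX f) = ~~ V (fX (fNot f)).
Proof. by rewrite val_not. Qed.

Definition valE :=
  (val_WX, val_iff, val_and, val_or, val_top, val_not, val_imp, val_bot).

End Connectives.

Fixpoint prop_atoms f : seq (formula Var) :=
  match f with
  | fBot => [::]
  | fImp g h => prop_atoms g ++ prop_atoms h
  | _ => [:: f]
  end.

Fixpoint reify (l : seq (formula Var)) f : pform :=
  match f with
  | fBot => pBot
  | fImp g h => pImp (reify l g) (reify l h)
  | _ => pAtom (index f l)
  end.

Lemma psubst_reify l f :
  {subset prop_atoms f <= l} -> psubst (nth fBot l) (reify l f) = f.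
Proof.
elim: f => [v||f IHf g IHg|f _|f _ g _] //= sub_l;
  try by rewrite nth_index // sub_l // mem_head.
by rewrite IHf ?IHg // => h hh; apply: sub_l; rewrite mem_cat hh ?orbT.
Qed.

(** Completeness of the propositional fragment. Variables, [fX] and [fW] formulae count as atoms,
    numbered by [reify]; an assignment of the atoms pulls back to a propositional valuation, so the
    reified formula is a tautology whose substitution instance is [f]. *)
Lemma provable_taut f : (forall V, prop_valuation V -> V f) -> provable f.
Proof.
move=> taut_f; rewrite -(@psubst_reify (prop_atoms f) f) //; apply: Taut => a.
apply: (taut_f (fun g => peval a (reify (prop_atoms f) g))).
by split=> // g h /=; rewrite implybE.
Qed.

Lemma provable_conseq h f : provable h ->
  (forall V, prop_valuation V -> V h -> V f) -> provable f.
Proof.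
move=> ph hf; apply: ModusPonens ph; apply: provable_taut => V hV.
by rewrite (valE hV); apply/implyP/hf.
Qed.

Lemma provable_conseq2 h1 h2 f : provable h1 -> provable h2 ->
  (forall V, prop_valuation V -> V h1 -> V h2 -> V f) -> provable f.
Proof.
move=> p1 p2 hf; apply: ModusPonens p2; apply: provable_conseq p1 _ => V hV Vh1.
by rewrite (valE hV); apply/implyP/hf.
Qed.

Lemma provable_and f g : provable f -> provable g -> provable (fAnd f g).
Proof.
by move=> pf pg; apply: (provable_conseq2 pf pg) => V hV Vf Vg;
  rewrite (valE hV) Vf Vg.
Qed.

(** * Derived laws of the strong next *)

Lemma provable_X_notnot f : provable (fIff (fX f) (fX (fNot (fNot f)))).
Proof.
apply: (@TautX _ (pAtom 0) (pImp (pImp (pAtom 0) pBot) pBot) (fun=> f)) => a /=.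
by case: (a 0).
Qed.

(** Distributing the weak next over the contrapositive gives [fWX (fNot g)] implies [fWX (fNot f)].
    Contraposing again leaves [fX] on double negations, which [provable_X_notnot] removes. *)
Lemma provable_X_mono f g :
  provable (fImp f g) -> provable (fImp (fX f) (fX g)).
Proof.
move=> pfg; have pNN := provable_and (provable_X_notnot f) (provable_X_notnot g).
have pc : provable (fWX (fImp (fNot g) (fNot f))).
  apply/WkNextStep/(provable_conseq pfg) => V hV; rewrite !(valE hV).
  by case: (V f); case: (V g).
have := provable_conseq2 pc (WkNextDistr (fNot g) (fNot f)).
move=> /(_ (fImp (fWX (fNot g)) (fWX (fNot f)))) pd.
apply: (provable_conseq2 pNN (pd _)) => V hV.
  by move=> Vc; rewrite (val_iff hV) Vc => /eqP <-.
rewrite !(valE hV) => /andP[/eqP-> /eqP->].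
by case: (V _); case: (V _).
Qed.

(** Distribution for [fImp f fBot] relates [fNot (fX f)], up to double negation, to [fWX f] implying
    [fWX fBot]; and [fWX fBot] is [fEnd] by definition. *)
Lemma provable_X_iff f :
  provable (fIff (fX f) (fAnd (fWX f) (fX fTop))).
Proof.
apply: (provable_conseq2 (provable_X_notnot f) (WkNextDistr f fBot)) => V hV.
rewrite !(valE hV) -![fImp _ fBot]/(fNot _) -/fTop => /eqP->.
by case: (V (fX (fNot f))); case: (V (fX fTop)); case: (V _).
Qed.

Lemma provable_not_X_bot : provable (fNot (fX (@fBot Var))).
Proof.
apply: (provable_conseq (provable_X_iff fBot)) => V hV; rewrite !(valE hV).
by rewrite -/fTop; case: (V (fX fTop)); case: (V _).
Qed.

(** Since [fOr f g] is the implication from [fNot f] to [g], the law [WkNextDistr] applies to it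
    directly. *)
Lemma provable_X_or f g : provable (fImp (fX (fOr f g)) (fOr (fX f) (fX g))).
Proof.
have p1 := provable_and (provable_X_iff (fOr f g)) (WkNextDistr (fNot f) g).
have p2 := provable_and (provable_X_notnot f) (provable_X_iff g).
apply: (provable_conseq2 p1 p2) => V hV; rewrite !(valE hV) -/(fOr f g).
move=> /andP[/eqP-> /eqP->] /andP[/eqP-> /eqP->].
by case: (V (fX fTop)); case: (V (fX (fNot g))); case: (V _).
Qed.

(** * Finite disjunctions *)

Section Disjunction.
Variables (I : finType) (P : pred I) (F : I -> formula Var).

Lemma provable_bigor_imp h : (forall i, P i -> provable (fImp (F i) h)) ->
  provable (fImp (\big[fOr/fBot]_(i | P i) F i) h).
Proof.
move=> pF; elim/big_rec: _ => [|i f /pF pi pf].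
  by apply: provable_taut => V hV; rewrite !(valE hV).
apply: (provable_conseq2 pi pf) => V hV; rewrite !(valE hV).
by case: (V h); case: (V (F i)); case: (V f).
Qed.

Lemma provable_imp_not_X_bigor h :
  (forall i, P i -> provable (fImp h (fNot (fX (F i))))) ->
  provable (fImp h (fNot (fX (\big[fOr/fBot]_(i | P i) F i)))).
Proof.
move=> pF; elim/big_rec: _ => [|i f /pF pi pf].
  apply: (provable_conseq provable_not_X_bot) => V hV; rewrite !(valE hV).
  by move=> ->; rewrite implybT.
apply: (provable_conseq2 (provable_and pi pf) (provable_X_or (F i) f)) => V hV.
rewrite !(valE hV).
by case: (V h) => //=; case: (V (fX (F i))); case: (V (fX f)); case: (V _).
Qed.

Lemma val_bigor V : prop_valuation V ->
  V (\big[fOr/fBot]_(i | P i) F i) = [exists (i | P i), V (F i)].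
Proof.
move=> hV; rewrite -big_orE.
by apply: big_morph => [f g|]; rewrite (valE hV).
Qed.

End Disjunction.

(** Otherwise [h] would propositionally entail [fNot f]. Each later use chooses for [h] the
    instances of the laws that its valuation must respect. *)
Lemma consistent_sat h f : ~ provable (fNot f) -> provable h ->
  exists V, [/\ prop_valuation V, V f & V h].
Proof.
move=> cf ph; apply: contrapT => nV; apply/cf/(provable_conseq ph) => V hV Vh.
by rewrite (valE hV); apply/negP => Vf; apply: nV; exists V.
Qed.

(** * Types over a finite list and their successor relation *)

Section Types.
Variable L : seq (formula Var).
Local Notation type := ((size L).-tuple bool).
Implicit Types t u : type.

(* Equal to [false] outside of [L]. *)
Definition at_type t f : bool := nth false t (index f L).

Definition type_of V : type := map_tuple V (in_tuple L).

Lemma at_type_of V f : f \in L -> at_type (type_of V) f = V f.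
Proof. by move=> fL; rewrite /at_type (nth_map f) ?nth_index ?index_mem. Qed.

Definition char t : formula Var :=
  \big[fAnd/fTop]_(f <- L) (if at_type t f then f else fNot f).

Lemma val_char V t : prop_valuation V ->
  V (char t) = all (fun f => V f == at_type t f) L.
Proof.
move=> hV; rewrite /char; elim: L => [|f l IHl]; rewrite ?big_nil ?big_cons /=.
  by rewrite (valE hV).
by rewrite (valE hV) IHl; case: at_type; rewrite ?(valE hV) ?eqb_id ?eqbF_neg.
Qed.

Lemma val_char_type_of V : prop_valuation V -> V (char (type_of V)).
Proof.
by move=> hV; rewrite val_char //; apply/allP => f fL; rewrite at_type_of.
Qed.

Lemma at_type_sat V t f : prop_valuation V -> V (char t) -> f \in L ->
  V f = at_type t f.
Proof. by move=> hV; rewrite val_char // => /allP Vt /Vt/eqP. Qed.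

Definition type_consistent t : Prop := ~ provable (fNot (char t)).

(** The classical boolean makes this a [rel] on a finite type, so that [connect] expresses
    reachability. *)
Definition next : rel type :=
  fun t u => ~~ `[< provable (fImp (char t) (fNot (fX (char u)))) >].

(** If [char u] were refutable, monotonicity would turn [fX (char u)] into [fX fBot], which is
    refutable. *)
Lemma next_consistentr t u : next t u -> type_consistent u.
Proof.
move=> /asboolPn tu pu; apply: tu.
have pX : provable (fImp (fX (char u)) (fX fBot)) by exact: provable_X_mono.
apply: (provable_conseq2 pX provable_not_X_bot) => V hV; rewrite !(valE hV).
by case: (V (fX fBot)) => // /negbTE->; rewrite implybT.
Qed.

Lemma provable_char_imp t f : f \in L ->
  provable (fImp (char t) (if at_type t f then f else fNot f)).
Proof.
move=> fL; apply: provable_taut => V hV; rewrite (valE hV); apply/implyP => Vt.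
by case: ifP (at_type_sat hV Vt fL) => _; rewrite ?(valE hV) => ->.
Qed.

(** One valuation sees both ends of a step: it agrees with [t] on [L] and reads the values of [u]
    under [fX]. The value at [fX (fNot f)] is included because [fWX f] is its negation; the two are
    complementary because [fX (char u)] forces [fX fTop]. *)
Lemma next_sat t u f h : next t u -> f \in L -> provable h ->
  exists V, [/\ prop_valuation V, V h, {in L, V =1 at_type t},
    V (fX f) = at_type u f & V (fX (fNot f)) = ~~ at_type u f].
Proof.
move=> /asboolPn tu fL ph.
have pX := provable_X_mono (provable_char_imp u fL).
have pT : provable (fImp (fX (char u)) (fX fTop)).
  by apply/provable_X_mono/provable_taut => V hV; rewrite !(valE hV) implybT.
have ctu : ~ provable (fNot (fAnd (char t) (fX (char u)))).
  move=> p; apply/tu/(provable_conseq p) => V hV; rewrite !(valE hV).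
  by rewrite negb_and implybE.
have [V [hV]] := consistent_sat ctu
  (provable_and ph (provable_and (provable_X_iff f) (provable_and pX pT))).
rewrite !(valE hV) => /andP[Vt Vu] /and4P[Vh + + VT]; rewrite Vu /= in VT *.
rewrite VT andbT => Vf Vc.
exists V; split=> //; first by move=> g; apply: at_type_sat.
  by case: at_type Vc Vf => /= [->|->] //= /eqP.
by case: at_type Vc Vf => /= [->|->] //= /eqP; case: (V _).
Qed.

Lemma type_sat t h : type_consistent t -> provable h ->
  exists V, [/\ prop_valuation V, V h & {in L, V =1 at_type t}].
Proof.
move=> ct /(consistent_sat ct)[V [hV Vt Vh]].
by exists V; split=> // f; apply: at_type_sat.
Qed.

Hypothesis XT_L : fX fTop \in L.

Lemma end_reachable t : type_consistent t ->
  exists2 u, connect next t u & ~~ at_type u (fX fTop).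
Proof.
move=> ct; apply: contrapT => no_end; apply: ct.
set r := \big[fOr/fBot]_(u | connect next t u) char u.
have r_end : provable (fImp r (fNot fEnd)).
  apply: provable_bigor_imp => u tu; apply: provable_taut => V hV.
  rewrite !(valE hV) negbK; apply/implyP => Vu.
  rewrite (at_type_sat hV Vu XT_L); apply: contrapT => /negP nu.
  by apply: no_end; exists u.
have r_next : provable (fImp r (fWX r)).
  apply: provable_bigor_imp => u tu.
  (* [r'] collects the types not reachable from [t]; a reachable type has no successor among
     them. *)
  pose r' := \big[fOr/fBot]_(w | ~~ connect next t w) char w.
  have p1 : provable (fImp (char u) (fNot (fX r'))).
    apply: provable_imp_not_X_bigor => w ntw; apply: contrapT => /asboolPn uw.
    by case/negP: ntw; apply: connect_trans tu (connect1 uw).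
  (* Every valuation satisfies the characteristic formula of its own type, so the disjunction of [r]
     and [r'] is propositionally valid. *)
  have p2 : provable (fImp (fX (fNot r)) (fX r')).
    apply/provable_X_mono/provable_taut => V hV; rewrite !(valE hV) implyNb.
    rewrite !val_bigor //; have := val_char_type_of hV.
    case: (boolP (connect next t (type_of V))) => tV VV; apply/orP.
      by left; apply/existsP; exists (type_of V); rewrite tV.
    by right; apply/existsP; exists (type_of V); rewrite tV.
  apply: (provable_conseq2 p1 p2) => V hV; rewrite !(valE hV).
  by case: (V (char u)) => //= /negbTE->; rewrite implybF.
(* Finiteness refutes [r], hence also its disjunct [char t]. *)
apply: (provable_conseq2 (Induction r_end r_next) (Finite_ax Var)) => V hV.
rewrite !(valE hV) => /implyP Vr; apply: contra => Vt; apply: Vr.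
by rewrite val_bigor //; apply/existsP; exists t; rewrite connect0.
Qed.

End Types.

(** * Subformulae and the semantic unrolling of the weak until *)

Fixpoint subformulas f : seq (formula Var) :=
  f :: match f with
       | fImp g h | fW g h => subformulas g ++ subformulas h
       | fX g => subformulas g
       | _ => [::]
       end.

Lemma subformulas_refl f : f \in subformulas f.
Proof. by case: f => *; rewrite mem_head. Qed.

Lemma eval_WP n (K : kripke Var n) f g (i : 'I_n) :
  reflect ((forall j : 'I_n, i <= j -> eval K f j) \/
      exists k : 'I_n, [/\ i <= k, eval K g k &
        forall j : 'I_n, i <= j < k -> eval K f j])
    (eval K (fW f g) i).
Proof.
apply: (iffP orP) => -[hf|].
- by left=> j ij; apply: (implyP (forallP hf j)).
- case/existsP=> k /and3P[ik gk /forallP hf]; right; exists k; split=> // j.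
  exact/implyP/hf.
- by left; apply/forallP => j; apply/implyP/hf.
case=> k [ik gk hf]; right; apply/existsP; exists k; apply/and3P; split=> //.
by apply/forallP => j; apply/implyP/hf.
Qed.

(** This and the next lemma mirror [WkUntilUnroll] semantically; at the last position the weak next
    is vacuously true. *)
Lemma eval_W_last n (K : kripke Var n) f g (i : 'I_n) : i.+1 = n ->
  eval K (fW f g) i = eval K g i || eval K f i.
Proof.
move=> in_; have max_i (j : 'I_n) : i <= j -> j = i.
  by move=> ij; apply/val_inj/eqP; rewrite eqn_leq ij -ltnS in_ ltn_ord.
apply/eval_WP/orP => [[hf|[k [ik gk _]]]|[gi|fi]].
- by right; apply: hf.
- by left; rewrite -(max_i k).
- by right; exists i; split=> // j; case: ltngtP.
- by left=> j /max_i->.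
Qed.

Lemma eval_W_step n (K : kripke Var n) f g (i j : 'I_n) : i.+1 = j ->
  eval K (fW f g) i = eval K g i || eval K f i && eval K (fW f g) j.
Proof.
move=> ij; have split_i (k : 'I_n) : i <= k -> k = i \/ j <= k.
  by rewrite leq_eqVlt ij => /orP[/eqP/val_inj|]; [left|right].
have lt_ij : i < j by rewrite -ij.
apply/eval_WP/orP => [[hf|[k [ik gk hf]]]|[gi|/andP[fi /eval_WP[hf|]]]].
- right; rewrite hf //=; apply/eval_WP; left=> k jk.
  exact/hf/(leq_trans (ltnW lt_ij)).
- have [<-|jk] := split_i k ik; [by left | right].
  rewrite hf ?leqnn ?(leq_trans lt_ij) //=; apply/eval_WP; right.
  exists k; split=> // l /andP[jl lk].
  by apply: hf; rewrite lk (leq_trans (ltnW lt_ij)).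
- by right; exists i; split=> // k; case: ltngtP.
- by left=> k /split_i[->|/hf].
case=> k [jk gk hf]; right; exists k; split=> // [|l /andP[/split_i]].
  exact: leq_trans (ltnW lt_ij) jk.
by case=> [->//|jl lk]; apply: hf; rewrite jl.
Qed.

(** * The truth lemma along a path of types *)

Section Truth.
Variables (L : seq (formula Var)) (t0 : (size L).-tuple bool).
Variable p : seq ((size L).-tuple bool).
Hypotheses (XT_L : fX fTop \in L) (t0_con : type_consistent t0).
Hypotheses (t0_path : path (@next L) t0 p).
Hypothesis last_end : ~~ at_type (last t0 p) (fX fTop).

Local Notation n := (size p).+1.
Let st i := nth t0 (t0 :: p) i.

Definition model : kripke Var n :=
  [tuple (fun v => at_type (st i) (fVar v)) | i < n].

Lemma state_next i : i < size p -> next (st i) (st i.+1).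
Proof. by move/(pathP t0): t0_path; apply. Qed.

Lemma state_consistent i : i < n -> type_consistent (st i).
Proof. by case: i => // i /state_next/next_consistentr. Qed.

Lemma state_last i : i.+1 = n -> ~~ at_type (st i) (fX fTop).
Proof. by case=> ->; rewrite /st nth_last. Qed.

(** Truth lemma, by induction on [f]. Consistency of each type settles the propositional cases, the
    relation [next] settles [fX], and the unrolling law settles [fW]. *)
Lemma eval_model f (i : 'I_n) : {subset subformulas f <= L} ->
  eval model f i = at_type (st i) f.
Proof.
move=> sub_L; have fL : f \in L by exact/sub_L/subformulas_refl.
have sat_i (j : 'I_n) h := @type_sat L (st j) h (state_consistent (ltn_ord j)).
elim: f i fL sub_L => [v||f IHf g IHg|f IHf|f IHf g IHg] i fL sub_L.
- by rewrite /= tnth_mktuple.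
(* [Finite_ax] only fills the theorem slot of [type_sat]; the value at [fBot] comes from
   [prop_valuation]. *)
- have [V [hV _ <-//]] := sat_i i _ (Finite_ax Var).
  by rewrite (valE hV).
- have sf : {subset subformulas f <= L}.
    by move=> h hf; apply: sub_L; rewrite inE mem_cat hf orbT.
  have sg : {subset subformulas g <= L}.
    by move=> h hf; apply: sub_L; rewrite inE mem_cat hf !orbT.
  have f'L := sf _ (subformulas_refl f); have gL := sg _ (subformulas_refl g).
  have [V [hV _ Vi]] := sat_i i _ (Finite_ax Var).
  by rewrite /= IHf // IHg // -!Vi ?(valE hV) -?implybE.
- have sf : {subset subformulas f <= L}.
    by move=> h hf; apply: sub_L; rewrite inE hf orbT.
  have f'L := sf _ (subformulas_refl f).
  rewrite /=; case: insubP => [j lt_ij ji|].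
    rewrite IHf // ji.
    have [V [_ _ Vi <- _]] := next_sat (@state_next i lt_ij) f'L (Finite_ax Var).
    by rewrite Vi.
  (* At the last position [fX f] is semantically false; its type rejects it too, because [fX f]
     implies [fX fTop]. *)
  rewrite -leqNgt => le_ni; have in_ : i.+1 = n.
    by apply/eqP; rewrite eqn_leq ltn_ord.
  have [V [hV + Vi]] := sat_i i _ (provable_X_iff f).
  rewrite !(valE hV) (Vi _ XT_L) (Vi _ fL) (negbTE (state_last in_)) andbF.
  by move/eqP.
- have sf : {subset subformulas f <= L}.
    by move=> h hf; apply: sub_L; rewrite inE mem_cat hf orbT.
  have sg : {subset subformulas g <= L}.
    by move=> h hf; apply: sub_L; rewrite inE mem_cat hf !orbT.
  have f'L := sf _ (subformulas_refl f); have gL := sg _ (subformulas_refl g).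
  (* Inner induction on the distance to the end: the value at [i] is computed from the value at
     [i.+1]. *)
  have [m] := ubnP (n - i); elim: m i => // m IHm i; rewrite ltnS => le_m.
  have [lt_ij|le_ni] := ltnP i.+1 n.
    rewrite (@eval_W_step _ _ _ _ i (Ordinal lt_ij)) //.
    rewrite IHf // IHg // IHm; last first.
      by apply: leq_trans le_m; rewrite /= ltn_sub2l.
    have [V [hV + Vi _]] :=
      next_sat (@state_next i lt_ij) fL (WkUntilUnroll f g).
    rewrite !(valE hV) (Vi _ fL) (Vi _ f'L) (Vi _ gL) => /eqP-> ->.
    by rewrite negbK.
  have in_ : i.+1 = n by apply/eqP; rewrite eqn_leq ltn_ord.
  rewrite eval_W_last // IHf // IHg //.
  (* The law for [fX] is taken at [fNot (fW f g)]: without [fX fTop] this strong next is false, so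
     [fWX (fW f g)] is true and unrolling leaves [g] or [f]. *)
  have [V [hV + Vi]] := sat_i i _
    (provable_and (WkUntilUnroll f g) (provable_X_iff (fNot (fW f g)))).
  rewrite !(valE hV) (Vi _ fL) (Vi _ f'L) (Vi _ gL) (Vi _ XT_L).
  rewrite (negbTE (state_last in_)) andbF.
  by case/andP=> /eqP-> /eqP->; rewrite andbT.
Qed.

End Truth.

(** * From consistency to a model *)

Lemma consistent_satisfiable f : ~ provable (fNot f) -> satisfiable f.
Proof.
move=> cf; pose L := fX fTop :: subformulas f.
have XT_L : fX fTop \in L by exact: mem_head.
have sub_L : {subset subformulas f <= L} by move=> g gf; rewrite inE gf orbT.
have fL := sub_L _ (subformulas_refl f).
have [t ct tf] : exists2 t : (size L).-tuple bool,
    type_consistent t & at_type t f.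
  (* Otherwise all types containing [f] are inconsistent, and so is their disjunction [r]; but a
     valuation satisfying [f] satisfies [r] through its own type. *)
  apply: contrapT => no_t; apply: cf.
  pose r := \big[fOr/fBot]_(t : (size L).-tuple bool | at_type t f) char t.
  have r_bot : provable (fImp r fBot).
    apply: provable_bigor_imp => t tf; apply: contrapT => ct.
    by apply: no_t; exists t.
  apply: (provable_conseq r_bot) => V hV; rewrite !(valE hV) implybF val_bigor //.
  apply: contra => Vf; apply/existsP; exists (type_of L V).
  by rewrite at_type_of // Vf val_char_type_of.
have [u /connectP[p t_p ->] u_end] := end_reachable XT_L ct.
exists (size p).+1, (ltn0Sn _), (model t p).
by rewrite (eval_model XT_L ct t_p u_end).
Qed.

End Completeness.

Theorem theorem4p28 (Var : Type) (P : pnp Var) :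
  consistent P -> satisfiable (literal P).
Proof. exact: consistent_satisfiable. Qed.
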